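(* Let $\mathcal{X}\subset\mathbb{R}^d$, let $\{f_\theta:\mathcal{X}\to\mathbb{R}\}_{\theta\in\Omega_\theta}$ be a parametric family of functions, let $\phi_\sigma:\mathbb{R}\to\mathbb{R}$ be a radial basis function, and let $A$ be a positive linear operator acting on functions on $\mathbb{R}$. Define, for $x,y\in\mathcal{X}$, $$k_\theta(x,y)=\bigl\langle A\phi_\sigma(\cdot-f_\theta(x)),\,A\phi_\sigma(\cdot-f_\theta(y))\bigr\rangle,\qquad k(x,y)=\int_{\Omega_\theta}k_\theta(x,y)\,d\theta .$$ Then $k$ is a positive definite kernel on $\mathcal{X}$. Moreover, for all samples $x_1,\dots,x_N\in\mathcal{X}$ and $y_1,\dots,y_M\in\mathcal{X}$, with smoothed empirical slices $$\hat p_{f_\theta}(t)=\frac1N\sum_{i=1}^N\phi_\sigma(t-f_\theta(x_i)),\qquad \hat q_{f_\theta}(t)=\frac1M\sum_{j=1}^M\phi_\sigma(t-f_\theta(y_j)),$$ the squared generalized sliced probability metric $$\zeta^2_{\mathcal{F}}(\hat p,\hat q)=\int_{\Omega_\theta}\|A\hat p_{f_\theta}-A\hat q_{f_\theta}\|_2^2\,d\theta$$ equals the squared maximum mean discrepancy with kernel $k$ between the two samples: $$\zeta^2_{\mathcal{F}}(\hat p,\hat q)=\frac1{N^2}\sum_{i,j=1}^N k(x_i,x_j)+\frac1{M^2}\sum_{i,j=1}^M k(y_i,y_j)-\frac{2}{MN}\sum_{i=1}^N\sum_{j=1}^M k(x_i,y_j).$$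
   Context: $\langle\cdot,\cdot\rangle$ and $\|\cdot\|_2$ are the $L^2$ inner product and norm of functions on $\mathbb{R}$; $d\theta$ denotes integration with respect to the uniform distribution on $\Omega_\theta$; $\phi_\sigma$ and $A$ are such that $A\phi_\sigma(\cdot-s)$ is square-integrable for every $s\in\mathbb{R}$ and the integrals over $\Omega_\theta$ are well defined and finite. ''Positive definite kernel'' is meant in the usual kernel-methods sense: $k$ is symmetric and $\sum_{i,j=1}^n c_ic_jk(z_i,z_j)\ge 0$ for all $n$, all $z_1,\dots,z_n\in\mathcal{X}$ and all $c_1,\dots,c_n\in\mathbb{R}$. *)

(* Defs.v *)
From HB Require Import structures.
From mathcomp Require Import all_boot all_order all_algebra.
From mathcomp Require Import all_classical all_reals all_analysis.

Set Implicit Arguments.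
Unset Strict Implicit.
Unset Printing Implicit Defensive.

Import Order.TTheory GRing.Theory Num.Theory.
Import numFieldNormedType.Exports.

Local Open Scope classical_set_scope.
Local Open Scope ring_scope.

Definition positive_definite_kernel (R : realType) (T : Type) (X : set T)
    (k : T -> T -> R) : Prop :=
  (forall x y, X x -> X y -> k x y = k y x) /\
  (forall (n : nat) (z : 'I_n -> T) (c : 'I_n -> R), (forall i, X (z i)) ->
     0 <= \sum_(i < n) \sum_(j < n) c i * c j * k (z i) (z j)).

Definition radial_basis_function (R : realType) (phi : R -> R) : Prop :=
  exists psi : R -> R, forall t, phi t = psi `|t|.

(* A is defined on a linear space V of functions (it is arbitrary outside V).
   Its values are considered in the L^2 sense, so linearity and positivity
   (nonnegative functions are sent to nonnegative functions) hold almost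
   everywhere; an operator that is linear and positive pointwise is a
   particular case. *)
Definition positive_linear_operator (R : realType) (V : set (R -> R))
    (A : (R -> R) -> (R -> R)) : Prop :=
  [/\ V (cst 0),
      forall (a : R) (f g : R -> R), V f -> V g ->
        V (fun t => a * f t + g t),
      forall (a : R) (f g : R -> R), V f -> V g ->
        {ae (@lebesgue_measure R), forall t,
           A (fun u => a * f u + g u) t = a * A f t + A g t}
    & forall f : R -> R, V f -> (forall t, 0 <= f t) ->
        {ae (@lebesgue_measure R), forall t, 0 <= A f t}].

Definition L2_inner (R : realType) (f g : R -> R) : R :=
  Rintegral (@lebesgue_measure R) setT (fun t => f t * g t).

Definition L2_norm (R : realType) (f : R -> R) : \bar R :=
  Lnorm (@lebesgue_measure R) 2%:E (EFin \o f).

Lemma inv_fine_measure_ge0 (R : realType) (dT : measure_display)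
    (T : measurableType dT) (mu : {measure set T -> \bar R}) (D : set T) :
  0 <= (fine (mu D))^-1.
Proof. by rewrite invr_ge0 fine_ge0. Qed.

(* The uniform distribution on D relative to a reference measure mu (Lebesgue
   measure, surface measure, counting measure, ...), E |-> mu (E & D) / mu D;
   a probability measure when 0 < mu D < +oo. *)
Definition uniform_distribution (R : realType) (dT : measure_display)
    (T : measurableType dT) (mu : {measure set T -> \bar R})
    (D : set T) (mD : measurable D) : {measure set T -> \bar R} :=
  mscale (NngNum (inv_fine_measure_ge0 mu D)) (mrestr mu mD).

Definition slice_kernel (R : realType) (T : Type) (phi : R -> R)
    (A : (R -> R) -> (R -> R)) (h : T -> R) (x y : T) : R :=
  L2_inner (A (fun t => phi (t - h x))) (A (fun t => phi (t - h y))).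

Definition sliced_kernel (R : realType) (dT : measure_display)
    (Theta : measurableType dT) (P : {measure set Theta -> \bar R})
    (Omega : set Theta) (T : Type) (f : Theta -> T -> R) (phi : R -> R)
    (A : (R -> R) -> (R -> R)) (x y : T) : R :=
  Rintegral P Omega (fun theta => slice_kernel phi A (f theta) x y).

Definition smoothed_slice (R : realType) (T : Type) (phi : R -> R) (h : T -> R)
    (N : nat) (x : 'I_N -> T) : R -> R :=
  fun t => N%:R^-1 * \sum_(i < N) phi (t - h (x i)).

(* Extended-real valued, so that its finiteness is part of any equality with
   a real number. *)
Definition squared_gspm (R : realType) (dT : measure_display)
    (Theta : measurableType dT) (P : {measure set Theta -> \bar R})
    (Omega : set Theta) (T : Type) (f : Theta -> T -> R) (phi : R -> R)
    (A : (R -> R) -> (R -> R)) (N M : nat) (x : 'I_N -> T) (y : 'I_M -> T)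
    : \bar R :=
  (\int[P]_(theta in Omega)
     (L2_norm (fun t => (A (smoothed_slice phi (f theta) x) t
                         - A (smoothed_slice phi (f theta) y) t)%R)) ^+ 2)%E.

Definition squared_mmd (R : realType) (T : Type) (k : T -> T -> R) (N M : nat)
    (x : 'I_N -> T) (y : 'I_M -> T) : R :=
  (N%:R ^+ 2)^-1 * (\sum_(i < N) \sum_(j < N) k (x i) (x j))
  + (M%:R ^+ 2)^-1 * (\sum_(i < M) \sum_(j < M) k (y i) (y j))
  - 2 / (M%:R * N%:R) * (\sum_(i < N) \sum_(j < M) k (x i) (y j)).

(* Main.v *)
(* Pool the two samples into a family z_a with weights w_a, 1/N on the x_i and
   -1/M on the y_j. By linearity, A p - A q = sum_a w_a A phi(. - f_theta(z_a))
   almost everywhere, so its squared L^2 norm is the quadratic form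
   sum_{a,b} w_a w_b k_theta(z_a, z_b), nonnegative for arbitrary weights.
   Integrating over theta gives both claims. *)
Require Import Defs.
From HB Require Import structures.
From mathcomp Require Import all_boot all_order all_algebra.
From mathcomp Require Import all_classical all_reals all_analysis.
From mathcomp Require Import measurable_realfun ring.

Set Implicit Arguments.
Unset Strict Implicit.
Unset Printing Implicit Defensive.

Import Order.TTheory GRing.Theory Num.Theory.
Import numFieldNormedType.Exports.

Local Open Scope classical_set_scope.
Local Open Scope ring_scope.

Section nonmeasurable_integral.
Context d (T : measurableType d) (R : realType).
Variable mu : {measure set T -> \bar R}.
Implicit Types f g : T -> \bar R.
Local Open Scope ereal_scope.

Import HBNNSimple.

(* No measurability: the integral of a nonnegative function is a supremum over
   the simple functions below it, and these can be cut off on a null set. *)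
Lemma ge0_ae_le_integral_nomeas f g :
  (forall x, 0 <= f x) -> (forall x, 0 <= g x) ->
  {ae mu, forall x, f x <= g x} -> \int[mu]_x f x <= \int[mu]_x g x.
Proof.
move=> f0 g0 [N [mN N0 sub]]; rewrite !ge0_integralTE//.
apply: ge_ereal_sup => _ /= [h hf <-].
have mNC : measurable (~` N) by exact: measurableC.
apply: ereal_sup_ubound; exists (proj_nnsfun h mNC) => /=.
  move=> x; rewrite mindicE; have [|] := boolP (x \in ~` N).
    rewrite inE => Nx; rewrite mulr1 (le_trans (hf x))//.
    by apply: contrapT => fgx; apply: Nx; exact: sub.
  by rewrite mulr0.
rewrite -[RHS]integralT_nnsfun -integralT_nnsfun.
apply: ge0_ae_eq_integral => //.
- exact/measurable_EFinP.
- exact/measurable_EFinP.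
- by move=> x _; rewrite lee_fin.
- by move=> x _; rewrite lee_fin.
- exists N; split=> // x /= hx; apply: contrapT => Nx; apply: hx => _.
  by rewrite mindicE mem_set// mulr1.
Qed.

(** Needed because only the [A (fun t => phi (t - s))] are assumed square-integrable: the image
    under [A] of a smoothed slice is known merely up to a null set, so its measurability cannot be
    invoked. *)
Lemma ge0_ae_eq_integral_nomeas f g :
  (forall x, 0 <= f x) -> (forall x, 0 <= g x) ->
  {ae mu, forall x, f x = g x} -> \int[mu]_x f x = \int[mu]_x g x.
Proof.
move=> f0 g0 fg; apply/eqP; rewrite eq_le; apply/andP.
split; apply: ge0_ae_le_integral_nomeas => //.
  by apply: filterS fg => x ->; rewrite lexx.
by apply: filterS fg => x ->; rewrite lexx.
Qed.

End nonmeasurable_integral.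

Section integral_linear_combination.
Context d (T : measurableType d) (R : realType).
Variables (mu : {measure set T -> \bar R}) (D : set T) (mD : measurable D).

Lemma integral_lincomb (I : finType) (c : I -> R) (F : I -> T -> R) :
  (forall i, mu.-integrable D (EFin \o F i)) ->
  (\int[mu]_(x in D) (\sum_i c i * F i x)%R%:E)%E
  = (\sum_i c i * Rintegral mu D (F i))%:E.
Proof.
move=> iF; under eq_integral do rewrite -sumEFin.
rewrite integral_sum//; last first.
  by move=> i; exact: (integrableZl mD (c i) (iF i)).
rewrite -sumEFin; apply: eq_bigr => i _ /=.
rewrite [LHS](integralZl mD (iF i)) EFinM /Rintegral fineK//.
exact: (integrable_fin_num mD (iF i)).
Qed.

(** Serves for both integrations: over the line, with products of two functions, and over the
    parameters, with the slice kernels. *)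
Lemma integral_quadratic (I : finType) (c : I -> R) (F : I -> I -> T -> R) :
  (forall i j, mu.-integrable D (EFin \o F i j)) ->
  (\int[mu]_(x in D) (\sum_i \sum_j c i * c j * F i j x)%R%:E)%E
  = (\sum_i \sum_j c i * c j * Rintegral mu D (F i j))%:E.
Proof.
move=> iF.
rewrite (pair_bigA _ (fun i j => c i * c j * Rintegral mu D (F i j))) /=.
rewrite -(@integral_lincomb _ (fun p => c p.1 * c p.2) (fun p => F p.1 p.2))//.
by apply: eq_integral => x _; rewrite pair_bigA.
Qed.

End integral_linear_combination.

Lemma sqr_lincomb (R : comPzRingType) (I : finType) (c g : I -> R) :
  (\sum_i c i * g i) ^+ 2 = \sum_i \sum_j c i * c j * (g i * g j).
Proof.
rewrite expr2 mulr_suml; apply: eq_bigr => i _; rewrite mulr_sumr.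
by apply: eq_bigr => j _; rewrite mulrACA.
Qed.

Section L2.
Variable R : realType.
Local Notation leb := (@lebesgue_measure R).

Lemma L2_norm_sqr (f : R -> R) :
  ((L2_norm f) ^+ 2 = \int[leb]_t ((f t) ^+ 2)%:E)%E.
Proof.
(* The square is turned into the real power [1 + 1], which cancels the root in [Lnorm]. *)
rewrite /L2_norm expe2 -{1 2}[Lnorm _ _ _]poweRe1 ?Lnorm_ge0// -poweRD; last first.
  by rewrite add_neq0_poweRD_def// pnatr_eq0.
rewrite poweR_Lnorm//.
apply: eq_integral => t _ /=.
by rewrite powR_mulrn// real_normK// num_real.
Qed.

Lemma integral_sqr_lincomb (I : finType) (c : I -> R) (g : I -> R -> R) :
  (forall i, g i \in Lfun leb 2%:E) ->
  (\int[leb]_t ((\sum_i c i * g i t) ^+ 2)%R%:E)%E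
  = (\sum_i \sum_j c i * c j * L2_inner (g i) (g j))%:E.
Proof.
move=> g2; rewrite -integral_quadratic//; last first.
  (* By Hölder's inequality the product of two L^2 functions is integrable. *)
  by move=> i j; apply/Lfun1_integrable; exact: Lfun2_mul_Lfun1.
by apply: eq_integral => t _; rewrite sqr_lincomb.
Qed.

(** A Gram form is the integral of the square of the combined function. *)
Lemma L2_inner_psd (I : finType) (c : I -> R) (g : I -> R -> R) :
  (forall i, g i \in Lfun leb 2%:E) ->
  0 <= \sum_i \sum_j c i * c j * L2_inner (g i) (g j).
Proof.
move=> g2; rewrite -lee_fin -integral_sqr_lincomb//.
by apply: integral_ge0 => t _; rewrite lee_fin sqr_ge0.
Qed.

(** Induction on the list: each term costs one more null set, and finitely many stay null.
    Membership in [V] is carried along because linearity is only available there. *)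
Lemma positive_linear_operator_sum (V : set (R -> R))
    (A : (R -> R) -> (R -> R)) (I : Type) (s : seq I) (c : I -> R)
    (g : I -> R -> R) :
  positive_linear_operator V A -> (forall i, V (g i)) ->
  V (fun t => \sum_(i <- s) c i * g i t) /\
  {ae leb, forall t,
    A (fun u => \sum_(i <- s) c i * g i u) t = \sum_(i <- s) c i * A (g i) t}.
Proof.
move=> [V0 VD AD _] Vg; elim: s => [|i s [Vs As]].
  have -> : (fun t => \sum_(i <- [::]) c i * g i t) = cst 0.
    by apply/funext => t; rewrite big_nil.
  (* The empty sum requires [A 0 = 0] almost everywhere; since 0 = -1 * 0 + 0, linearity gives
     [A 0 = - A 0 + A 0]. *)
  split=> //; have := AD (-1) _ _ V0 V0.
  have -> : (fun u : R => -1 * @cst R R 0 u + @cst R R 0 u) = cst 0.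
    by apply/funext => t /=; rewrite mulr0 addr0.
  apply: filterS; first exact: (ae_filter_ringOfSetsType leb).
  by move=> t ->; rewrite big_nil mulN1r addNr.
have -> : (fun t => \sum_(j <- i :: s) c j * g j t)
    = (fun t => c i * g i t + \sum_(j <- s) c j * g j t).
  by apply/funext => t; rewrite big_cons.
split; first exact: VD.
have := AD (c i) _ _ (Vg i) Vs; move: As.
apply: filterS2; first exact: (ae_filter_ringOfSetsType leb).
by move=> t As ->; rewrite As big_cons.
Qed.

End L2.

Definition sample_weight (R : realType) (N M : nat) (a : 'I_N + 'I_M) : R :=
  match a with inl _ => N%:R^-1 | inr _ => - M%:R^-1 end.

Definition pooled_sample (T : Type) (N M : nat) (x : 'I_N -> T) (y : 'I_M -> T)
    (a : 'I_N + 'I_M) : T :=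
  match a with inl i => x i | inr j => y j end.

(** The pooled double sum splits into four blocks; by symmetry the two mixed ones coincide, whence
    the factor 2. *)
Lemma squared_mmd_pooled (R : realType) (T : Type) (k : T -> T -> R)
    (N M : nat) (x : 'I_N -> T) (y : 'I_M -> T) :
  (forall i j, k (y j) (x i) = k (x i) (y j)) ->
  squared_mmd k x y
  = \sum_a \sum_b sample_weight R a * sample_weight R b *
      k (pooled_sample x y a) (pooled_sample x y b).
Proof.
move=> ksym; rewrite big_sumType /=.
under eq_bigr do rewrite big_sumType /= -!mulr_sumr.
under [X in _ = _ + X]eq_bigr do rewrite big_sumType /= -!mulr_sumr.
rewrite !big_split/= -!mulr_sumr.
have -> : \sum_(j < M) \sum_(i < N) k (y j) (x i)
    = \sum_(i < N) \sum_(j < M) k (x i) (y j).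
  by rewrite exchange_big; apply: eq_bigr => i _; apply: eq_bigr.
rewrite /squared_mmd -!exprVn invfM; ring.
Qed.

Section sliced.
Variables (R : realType) (T : Type) (phi : R -> R) (V : set (R -> R)).
Variable A : (R -> R) -> (R -> R).
Hypothesis A_pos : positive_linear_operator V A.
Hypothesis phi_V : forall s : R, V (fun t => phi (t - s)).
Hypothesis Aphi_L2 : forall s : R,
  A (fun t => phi (t - s)) \in Lfun (@lebesgue_measure R) 2%:E.

Lemma smoothed_slice_image (h : T -> R) (N : nat) (x : 'I_N -> T) :
  {ae (@lebesgue_measure R), forall t, A (smoothed_slice phi h x) t
     = \sum_(i < N) N%:R^-1 * A (fun u => phi (u - h (x i))) t}.
Proof.
have -> : smoothed_slice phi h x
    = (fun t => \sum_(i < N) N%:R^-1 * phi (t - h (x i))).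
  by apply/funext => t; rewrite /smoothed_slice mulr_sumr.
exact: (positive_linear_operator_sum _ (fun=> N%:R^-1) A_pos
  (fun i => phi_V (h (x i)))).2.
Qed.

(** The exceptional null sets concern [t] only and vanish in the norm, so the identity is exact for
    each slice [h], with no exceptional parameters. *)
Lemma L2_norm_smoothed_slices (h : T -> R) (N M : nat)
    (x : 'I_N -> T) (y : 'I_M -> T) :
  ((L2_norm (fun t =>
      (A (smoothed_slice phi h x) t - A (smoothed_slice phi h y) t)%R)) ^+ 2)%E
  = (\sum_a \sum_b sample_weight R a * sample_weight R b *
      slice_kernel phi A h (pooled_sample x y a) (pooled_sample x y b))%:E.
Proof.
rewrite L2_norm_sqr -integral_sqr_lincomb//.
apply: ge0_ae_eq_integral_nomeas => [t|t|]; rewrite ?lee_fin ?sqr_ge0//.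
move: (smoothed_slice_image h x) (smoothed_slice_image h y).
apply: filterS2; first exact: (ae_filter_ringOfSetsType lebesgue_measure).
move=> t -> ->; rewrite big_sumType /=; congr ((_ + _) ^+ 2)%:E.
by rewrite -sumrN; apply: eq_bigr => j _; rewrite mulNr.
Qed.

End sliced.

Theorem mainTheorem3 (R : realType) (d : nat) (X : set 'rV[R]_d)
    (dT : measure_display) (Theta : measurableType dT)
    (mu : {measure set Theta -> \bar R})
    (Omega : set Theta) (mOmega : measurable Omega)
    (mu_gt0 : (0 < mu Omega)%E) (mu_fin : (mu Omega < +oo)%E)
    (f : Theta -> 'rV[R]_d -> R)
    (phi_sigma : R -> R) (phi_rbf : radial_basis_function phi_sigma)
    (V : set (R -> R)) (A : (R -> R) -> (R -> R))
    (A_pos : positive_linear_operator V A)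
    (phi_V : forall s : R, V (fun t => phi_sigma (t - s)))
    (Aphi_L2 : forall s : R,
       A (fun t => phi_sigma (t - s)) \in Lfun (@lebesgue_measure R) 2%:E)
    (k_int : forall x y : 'rV[R]_d, X x -> X y ->
       (uniform_distribution mu mOmega).-integrable Omega
         (fun theta => (slice_kernel phi_sigma A (f theta) x y)%:E)) :
  let k := sliced_kernel (uniform_distribution mu mOmega) Omega f phi_sigma A in
  positive_definite_kernel X k /\
  (forall (N M : nat) (x : 'I_N -> 'rV[R]_d) (y : 'I_M -> 'rV[R]_d),
     (0 < N)%N -> (0 < M)%N -> (forall i, X (x i)) -> (forall j, X (y j)) ->
     squared_gspm (uniform_distribution mu mOmega) Omega f phi_sigma A x y
     = (squared_mmd k x y)%:E).
Proof.
move=> k.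
have k_sym x y : k x y = k y x.
  (* Symmetry descends through both integrals to the commutativity of a pointwise product. *)
  congr fine; apply: eq_integral => theta _; congr (_%:E).
  by congr fine; apply: eq_integral => t _; rewrite mulrC.
split; first split=> // n z c Xz.
  (* With the finite sums moved under the integral over [theta], the integrand is a Gram form for
     each [theta]. *)
  rewrite -lee_fin -integral_quadratic//; last by move=> i j; exact: k_int.
  apply: integral_ge0 => theta _; rewrite lee_fin.
  exact: (L2_inner_psd c (fun i => Aphi_L2 (f theta (z i)))).
move=> N M x y _ _ Xx Xy; rewrite squared_mmd_pooled//.
(* Both sides become integrals over [Omega], whose integrands agree at every [theta]. *)
rewrite -integral_quadratic//; last first.
  by move=> a b; apply: k_int; [case: a|case: b].
by apply: eq_integral => theta _; exact: (L2_norm_smoothed_slices A_pos).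
Qed.
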